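(* Let $G\subset\mathbb{R}^3$ be a domain, let $p,q$ be complex valued functions on $G$ with $p\in C^2(G)$ and $p\neq0$ in $G$, and let $u_0$ be a nonvanishing (complex valued, twice continuously differentiable) solution of $$(\operatorname{div}p\operatorname{grad}+q)u=0\qquad\text{in }G .$$ Then for any scalar (complex valued) function $\varphi\in C^2(G)$ the following equality holds: $$(\operatorname{div}p\operatorname{grad}+q)\varphi=-p^{1/2}\left(D+M^{\frac{Df}{f}}\right)\left(D-M^{\frac{Df}{f}}\right)\left(p^{1/2}\varphi\right),$$ where $f=p^{1/2}u_0$.
   Context: $\mathbb{H}(\mathbb{C})$ is the algebra of complex quaternions $Q=Q_0+Q_1\mathbf i+Q_2\mathbf j+Q_3\mathbf k$, $Q_0,\dots,Q_3\in\mathbb{C}$, where $\mathbf i,\mathbf j,\mathbf k$ are the quaternionic imaginary units, commuting with the complex imaginary unit $i$. $Q$ is scalar if $Q_1=Q_2=Q_3=0$. For differentiable $\mathbb{H}(\mathbb{C})$-valued $Q$ of $(x,y,z)$, $DQ=\mathbf i\,\partial_xQ+\mathbf j\,\partial_yQ+\mathbf k\,\partial_zQ$ (for scalar $f$, $Df$ is identified with $\operatorname{grad}f$). $M^PQ=Q\cdot P$ is multiplication by $P$ from the right. $\operatorname{div}$, $\operatorname{grad}$ are with respect to $(x,y,z)$, and $(\operatorname{div}p\operatorname{grad}+q)\varphi=\operatorname{div}(p\operatorname{grad}\varphi)+q\varphi$. $p^{1/2}$ denotes one fixed twice continuously differentiable function on $G$ whose square is $p$. *)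

(* Defs.v *)
From Stdlib Require Import Reals.
From Coquelicot Require Import Coquelicot.

Definition point : Type := (R * R * R)%type.

(* Connectedness in R^3, tested with open subsets of the ambient space.  For an
   open set G this is the same as testing with relatively open subsets of G. *)
Definition connected (G : point -> Prop) : Prop :=
  forall U V : point -> Prop, open U -> open V ->
    (forall P, G P -> U P \/ V P) ->
    (exists P, G P /\ U P) -> (exists P, G P /\ V P) ->
    exists P, G P /\ U P /\ V P.

Definition is_domain (G : point -> Prop) : Prop :=
  open G /\ connected G /\ exists P, G P.

Inductive axis : Set := ax_x | ax_y | ax_z.

Definition coord (a : axis) (P : point) : R :=
  let '(x, y, z) := P in
  match a with ax_x => x | ax_y => y | ax_z => z end.

Definition set_coord (a : axis) (P : point) (t : R) : point :=
  let '(x, y, z) := P in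
  match a with
  | ax_x => (t, y, z)
  | ax_y => (x, t, z)
  | ax_z => (x, y, t)
  end.

Definition along (F : point -> C) (a : axis) (P : point) : R -> C :=
  fun t => F (set_coord a P t).

(* Coquelicot's [Derive] only takes real-valued functions; this is the
   derivative of a complex-valued function of a real variable, see
   [CDerive_correct] and [CDerive_unique]. *)
Definition CDerive (g : R -> C) (t : R) : C :=
  (Derive (fun s => Re (g s)) t, Derive (fun s => Im (g s)) t).

Definition ex_partial (a : axis) (F : point -> C) (P : point) : Prop :=
  ex_derive (K := R_AbsRing) (V := C_R_NormedModule) (along F a P) (coord a P).

Definition partial (a : axis) (F : point -> C) (P : point) : C :=
  CDerive (along F a P) (coord a P).

(* F is k times continuously differentiable on G (for G open): all partial
   derivatives of order at most k exist and are continuous at every point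
   of G.  Functions are total on R^3, but for G open only their values on G
   matter here. *)
Fixpoint Ck (k : nat) (G : point -> Prop) (F : point -> C) : Prop :=
  (forall P, G P -> continuous F P) /\
  match k with
  | O => True
  | S k' => forall a : axis,
      (forall P, G P -> ex_partial a F P) /\ Ck k' G (partial a F)
  end.

Definition grad (F : point -> C) (P : point) : axis -> C :=
  fun a => partial a F P.

Definition div (V : point -> axis -> C) (P : point) : C :=
  (partial ax_x (fun S => V S ax_x) P +
   partial ax_y (fun S => V S ax_y) P +
   partial ax_z (fun S => V S ax_z) P)%C.

Definition div_p_grad_plus_q (p q F : point -> C) (P : point) : C :=
  (div (fun S a => p S * grad F S a) P + q P * F P)%C.

Record HC : Type := mkHC { Q0 : C; Q1 : C; Q2 : C; Q3 : C }.

Definition Hscalar (c : C) : HC := mkHC c 0 0 0.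
Definition Hi : HC := mkHC 0 1 0 0.
Definition Hj : HC := mkHC 0 0 1 0.
Definition Hk : HC := mkHC 0 0 0 1.

Definition Hplus (A B : HC) : HC :=
  mkHC (Q0 A + Q0 B) (Q1 A + Q1 B) (Q2 A + Q2 B) (Q3 A + Q3 B).

Definition Hscale (c : C) (A : HC) : HC :=
  mkHC (c * Q0 A) (c * Q1 A) (c * Q2 A) (c * Q3 A).

Definition Hminus (A B : HC) : HC :=
  mkHC (Q0 A - Q0 B) (Q1 A - Q1 B) (Q2 A - Q2 B) (Q3 A - Q3 B).

Definition Hmult (A B : HC) : HC :=
  mkHC
    (Q0 A * Q0 B - Q1 A * Q1 B - Q2 A * Q2 B - Q3 A * Q3 B)
    (Q0 A * Q1 B + Q1 A * Q0 B + Q2 A * Q3 B - Q3 A * Q2 B)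
    (Q0 A * Q2 B - Q1 A * Q3 B + Q2 A * Q0 B + Q3 A * Q1 B)
    (Q0 A * Q3 B + Q1 A * Q2 B - Q2 A * Q1 B + Q3 A * Q0 B).

Definition Hpartial (a : axis) (Q : point -> HC) (P : point) : HC :=
  mkHC (partial a (fun S => Q0 (Q S)) P) (partial a (fun S => Q1 (Q S)) P)
       (partial a (fun S => Q2 (Q S)) P) (partial a (fun S => Q3 (Q S)) P).

Definition D_op (Q : point -> HC) (P : point) : HC :=
  Hplus (Hplus (Hmult Hi (Hpartial ax_x Q P))
               (Hmult Hj (Hpartial ax_y Q P)))
        (Hmult Hk (Hpartial ax_z Q P)).

Definition M_op (A : point -> HC) (Q : point -> HC) (P : point) : HC :=
  Hmult (Q P) (A P).

Definition op_plus (S T : (point -> HC) -> point -> HC) :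
    (point -> HC) -> point -> HC :=
  fun Q P => Hplus (S Q P) (T Q P).

Definition op_minus (S T : (point -> HC) -> point -> HC) :
    (point -> HC) -> point -> HC :=
  fun Q P => Hminus (S Q P) (T Q P).

Definition scalar_field (F : point -> C) : point -> HC :=
  fun P => Hscalar (F P).

(* Df / f; the factor 1 / f is scalar, hence central. *)
Definition D_log (f : point -> C) (P : point) : HC :=
  Hscale (/ f P) (D_op (scalar_field f) P).

Lemma Hmult_units :
  Hmult Hi Hi = Hscalar (-1) /\ Hmult Hj Hj = Hscalar (-1) /\
  Hmult Hk Hk = Hscalar (-1) /\ Hmult Hi Hj = Hk /\ Hmult Hj Hk = Hi /\
  Hmult Hk Hi = Hj.
Proof.
repeat split; unfold Hmult, Hscalar, Hi, Hj, Hk; simpl; f_equal;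
  apply injective_projections; simpl; ring.
Qed.

Lemma Hmult_assoc (A B E : HC) : Hmult A (Hmult B E) = Hmult (Hmult A B) E.
Proof. destruct A, B, E; unfold Hmult; simpl; f_equal; ring. Qed.

Lemma D_scalar_field (f : point -> C) (P : point) :
  D_op (scalar_field f) P =
  mkHC 0 (grad f P ax_x) (grad f P ax_y) (grad f P ax_z).
Proof.
assert (H0 : forall a, partial a (fun _ => 0%C) P = 0%C).
{ intro a; unfold partial, CDerive, along; simpl.
  now rewrite !Derive_const. }
unfold D_op, Hpartial, scalar_field, Hscalar, Hplus, Hmult, Hi, Hj, Hk, grad.
simpl; rewrite !H0.
change (fun S => f S) with f.
generalize (partial ax_x f P) (partial ax_y f P) (partial ax_z f P).
intros [a1 a2] [b1 b2] [c1 c2].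
f_equal; apply injective_projections; simpl; ring.
Qed.

Lemma CDerive_unique (g : R -> C) (t : R) (l : C) :
  is_derive (K := R_AbsRing) (V := C_R_NormedModule) g t l -> CDerive g t = l.
Proof.
intro H; destruct l as [l1 l2]; unfold CDerive; f_equal;
  apply is_derive_unique.
- exact (filterdiff_comp' (K := R_AbsRing) (U := R_NormedModule)
    (V := C_R_NormedModule) (W := R_NormedModule) g (fun z => fst z) t
    (fun y => scal y (l1, l2)) (fun z => fst z) H
    (filterdiff_linear _ (is_linear_fst (U := R_NormedModule)
       (V := R_NormedModule)))).
- exact (filterdiff_comp' (K := R_AbsRing) (U := R_NormedModule)
    (V := C_R_NormedModule) (W := R_NormedModule) g (fun z => snd z) t
    (fun y => scal y (l1, l2)) (fun z => snd z) H
    (filterdiff_linear _ (is_linear_snd (U := R_NormedModule)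
       (V := R_NormedModule)))).
Qed.

Lemma CDerive_correct (g : R -> C) (t : R) :
  ex_derive (K := R_AbsRing) (V := C_R_NormedModule) g t ->
  is_derive (K := R_AbsRing) (V := C_R_NormedModule) g t (CDerive g t).
Proof. intros [l Hl]; now rewrite (CDerive_unique g t l Hl). Qed.

(* Main.v *)
Require Import Defs.
From Stdlib Require Import Reals.
From Coquelicot Require Import Coquelicot.

(** Write [s] for the square root of [p] and [u] for the given solution.  For a
    scalar [psi = s phi], the field [(D - M^(Df/f)) psi] is purely vectorial
    ([D_minus_M_scalar]), with components
    [d_a psi - psi d_a f / f = s (d_a phi - phi d_a u / u)].  This is
    [W = f grad w] with [w = phi / u], and the derivatives of [s] have dropped
    out, so [W] can be differentiated once more.

    On a vectorial field, [D] is minus the divergence plus the curl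
    ([D_vector_field]), and right multiplication by [A = grad f / f] is minus the
    scalar product plus the vector product.  The vector part of
    [(D + M^(Df/f)) W] is thus [curl W + W x A]; it vanishes because
    [curl (f grad w) = grad f x grad w], which rests on the symmetry of the second
    partial derivatives of [phi] and [u] ([partial_comm]).  The scalar part is
    [- (div W + W . A)]; multiplied by [- s] it becomes
    [s (f Laplacian w + 2 grad f . grad w)], and this is
    [div (p grad phi) + q phi] once [q] is eliminated through the equation
    satisfied by [u].

    At a fixed point both sides are rational expressions in the values and in
    the first and second partial derivatives of [s], [u] and [phi].  The proof
    works with these expressions directly, without introducing [w]. *)

(** * Coordinate lines and planes in space *)

Lemma continuous_pair {T U V : UniformSpace} (g : T -> U) (h : T -> V) (x : T) :
  continuous g x -> continuous h x -> continuous (fun t => (g t, h t)) x.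
Proof.
intros Hg Hh.
apply (continuous_comp_2 g h (fun u v => (u, v)) x Hg Hh).
apply (continuous_ext (fun z : U * V => z)); [intros [u v]; reflexivity|].
apply continuous_id.
Qed.

Lemma set_coord_id (a : axis) (P : point) : set_coord a P (coord a P) = P.
Proof. now destruct P as [[x y] z], a. Qed.

Lemma coord_set_coord (a : axis) (P : point) (t : R) :
  coord a (set_coord a P t) = t.
Proof. now destruct P as [[x y] z], a. Qed.

Lemma set_coord_twice (a : axis) (P : point) (s t : R) :
  set_coord a (set_coord a P t) s = set_coord a P s.
Proof. now destruct P as [[x y] z], a. Qed.

Lemma set_coord_comm (a b : axis) (P : point) (s t : R) : a <> b ->
  set_coord a (set_coord b P t) s = set_coord b (set_coord a P s) t.
Proof.
intro Hab; destruct P as [[x y] z], a, b; simpl; congruence.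
Qed.

(** The coordinate plane (for distinct axes) through [P], with the
    coordinates along [a] and [b] as parameters. *)
Definition plane (a b : axis) (P : point) (z : R * R) : point :=
  set_coord a (set_coord b P (snd z)) (fst z).

Lemma plane_id (a b : axis) (P : point) : plane a b P (coord a P, coord b P) = P.
Proof. unfold plane; simpl; now rewrite !set_coord_id. Qed.

Lemma continuous_plane (a b : axis) (P : point) (z : R * R) :
  continuous (plane a b P) z.
Proof.
destruct P as [[x y] w], a, b, z as [s t]; unfold plane; simpl;
  repeat apply continuous_pair;
  first [ apply continuous_const | apply continuous_fst | apply continuous_snd ].
Qed.

Lemma continuous_set_coord (a : axis) (P : point) (t : R) :
  continuous (set_coord a P) t.
Proof.
destruct P as [[x y] w], a; unfold set_coord;
  repeat apply continuous_pair;
  first [ apply continuous_const | apply continuous_id ].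
Qed.

Lemma open_locally_line (G : point -> Prop) (a : axis) (P : point) :
  open G -> G P -> locally (coord a P) (fun t => G (set_coord a P t)).
Proof.
intros HG HP; apply (continuous_set_coord a P (coord a P)).
rewrite set_coord_id; now apply HG.
Qed.

Lemma open_locally_plane (G : point -> Prop) (a b : axis) (P : point) :
  open G -> G P ->
  locally_2d (fun u v => G (plane a b P (u, v))) (coord a P) (coord b P).
Proof.
intros HG HP; apply locally_2d_locally.
generalize (continuous_plane a b P (coord a P, coord b P) G).
rewrite plane_id; intro H.
generalize (H (HG P HP)); unfold filtermap; apply filter_imp.
now intros [u v].
Qed.

(** * Calculus of partial derivatives of complex-valued functions *)

(** [l] is the partial derivative of [F] at [P] along [a].  Differentiability
    is required of the real and imaginary parts separately, so that the rules of
    real calculus apply. *)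
Definition is_partial (a : axis) (F : point -> C) (P : point) (l : C) : Prop :=
  is_derive (fun t => Re (along F a P t)) (coord a P) (Re l) /\
  is_derive (fun t => Im (along F a P t)) (coord a P) (Im l).

Lemma is_partial_unique (a : axis) (F : point -> C) (P : point) (l : C) :
  is_partial a F P l -> partial a F P = l.
Proof.
intros [H1 H2]; unfold partial, CDerive; destruct l as [l1 l2].
now f_equal; apply is_derive_unique.
Qed.

Lemma ex_partial_correct (a : axis) (F : point -> C) (P : point) :
  ex_partial a F P -> is_partial a F P (partial a F P).
Proof.
intro H; apply CDerive_correct in H.
fold (partial a F P) in H; split.
- exact (filterdiff_comp' (K := R_AbsRing) (U := R_NormedModule)
    (V := C_R_NormedModule) (W := R_NormedModule) _ (fun z => fst z) _
    (fun y => scal y (partial a F P)) (fun z => fst z) H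
    (filterdiff_linear _ (is_linear_fst (U := R_NormedModule)
       (V := R_NormedModule)))).
- exact (filterdiff_comp' (K := R_AbsRing) (U := R_NormedModule)
    (V := C_R_NormedModule) (W := R_NormedModule) _ (fun z => snd z) _
    (fun y => scal y (partial a F P)) (fun z => snd z) H
    (filterdiff_linear _ (is_linear_snd (U := R_NormedModule)
       (V := R_NormedModule)))).
Qed.

Lemma is_partial_ext_open (G : point -> Prop) (a : axis) (F H : point -> C)
    (P : point) (l : C) :
  open G -> G P -> (forall S, G S -> F S = H S) ->
  is_partial a F P l -> is_partial a H P l.
Proof.
intros HG HP Heq [H1 H2].
split; [refine (is_derive_ext_loc _ _ _ _ _ H1)
       |refine (is_derive_ext_loc _ _ _ _ _ H2)];
  generalize (open_locally_line G a P HG HP); apply filter_imp;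
  intros t Ht; unfold along; now rewrite Heq.
Qed.

Lemma is_partial_minus (a : axis) (F H : point -> C) (P : point) (l m : C) :
  is_partial a F P l -> is_partial a H P m ->
  is_partial a (fun S => F S - H S)%C P (l - m)%C.
Proof.
intros [F1 F2] [H1 H2]; split.
- exact (is_derive_minus _ _ _ _ _ F1 H1).
- exact (is_derive_minus _ _ _ _ _ F2 H2).
Qed.

Lemma is_partial_mult (a : axis) (F H : point -> C) (P : point) (l m : C) :
  is_partial a F P l -> is_partial a H P m ->
  is_partial a (fun S => F S * H S)%C P (l * H P + F P * m)%C.
Proof.
intros [F1 F2] [H1 H2].
assert (Hc : forall n m : R_AbsRing, mult n m = mult m n) by exact Rmult_comm.
split.
- generalize (is_derive_minus _ _ _ _ _ (is_derive_mult _ _ _ _ _ F1 H1 Hc)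
    (is_derive_mult _ _ _ _ _ F2 H2 Hc)).
  unfold along; rewrite set_coord_id.
  match goal with |- is_derive _ _ ?x -> is_derive _ _ ?y =>
    replace x with y; [exact (fun h => h)|] end.
  unfold minus, plus, opp, mult; unfold Re, Im; simpl; ring.
- generalize (is_derive_plus _ _ _ _ _ (is_derive_mult _ _ _ _ _ F1 H2 Hc)
    (is_derive_mult _ _ _ _ _ F2 H1 Hc)).
  unfold along; rewrite set_coord_id.
  match goal with |- is_derive _ _ ?x -> is_derive _ _ ?y =>
    replace x with y; [exact (fun h => h)|] end.
  unfold minus, plus, opp, mult; unfold Re, Im; simpl; ring.
Qed.

(** The parts of [1 / (g + i h)] are of this form, with [k = g] and [k = - h]. *)
Lemma is_derive_div_norm2 (g h k : R -> R) (t g' h' k' : R) :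
  is_derive g t g' -> is_derive h t h' -> is_derive k t k' ->
  (g t ^ 2 + h t ^ 2)%R <> 0%R ->
  is_derive (fun s => k s / (g s ^ 2 + h s ^ 2))%R t
    ((k' * (g t ^ 2 + h t ^ 2) - k t * (2 * g t * g' + 2 * h t * h')) /
     (g t ^ 2 + h t ^ 2) ^ 2)%R.
Proof.
intros Hg Hh Hk HN.
auto_derive.
- repeat split; try assumption; now eexists; eassumption.
- rewrite (is_derive_unique (fun s : R => g s) _ _ Hg),
    (is_derive_unique (fun s : R => h s) _ _ Hh),
    (is_derive_unique (fun s : R => k s) _ _ Hk).
  now field.
Qed.

Lemma Cnorm2_neq_0 (c : C) : c <> 0%C -> (Re c ^ 2 + Im c ^ 2)%R <> 0%R.
Proof.
intros Hc H; apply Hc; destruct c as [x y]; unfold Re, Im in H; simpl in H.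
rewrite !Rmult_1_r in H.
destruct (Rplus_sqr_eq_0 x y H) as [-> ->]; reflexivity.
Qed.

Lemma is_partial_inv (a : axis) (F : point -> C) (P : point) (l : C) :
  F P <> 0%C -> is_partial a F P l ->
  is_partial a (fun S => / F S)%C P (- l / (F P * F P))%C.
Proof.
intros HF [F1 F2].
assert (N := Cnorm2_neq_0 _ HF).
assert (E : along F a P (coord a P) = F P)
  by (unfold along; now rewrite set_coord_id).
assert (N' := N); rewrite <- E in N'.
assert (HRe := is_derive_div_norm2 _ _ _ _ _ _ _ F1 F2 F1 N').
assert (HIm :=
  is_derive_div_norm2 _ _ _ _ _ _ _ F1 F2 (is_derive_opp _ _ _ F2) N').
cbv beta in HRe, HIm; rewrite E in HRe, HIm.
(* Multiplying by the square of the conjugate of [F P] makes the denominator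
   real, so that real and imaginary parts can be read off. *)
replace (- l / (F P * F P))%C with
  (- l * (Re (F P), - Im (F P))%R * (Re (F P), - Im (F P))%R *
   RtoC (/ (Re (F P) ^ 2 + Im (F P) ^ 2) ^ 2))%C.
- split.
  + match type of HRe with is_derive _ _ ?x =>
      match goal with |- is_derive _ _ ?y => replace y with x; [exact HRe|] end end.
    destruct l as [l1 l2], (F P) as [x y]; unfold Re, Im in *; simpl in *.
    field; intro H0; apply N; rewrite <- H0; ring.
  + match type of HIm with is_derive _ _ ?x =>
      match goal with |- is_derive _ _ ?y => replace y with x; [exact HIm|] end end.
    destruct l as [l1 l2], (F P) as [x y]; unfold Re, Im, opp in *; simpl in *.
    field; intro H0; apply N; rewrite <- H0; ring.
- assert (HN : (F P * (Re (F P), - Im (F P))%R =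
                RtoC (Re (F P) ^ 2 + Im (F P) ^ 2))%C).
  { destruct (F P) as [x y]; apply injective_projections; unfold Re, Im; simpl;
      ring. }
  rewrite RtoC_inv, RtoC_pow, <- HN by now apply pow_nonzero.
  assert ((Re (F P), - Im (F P))%R <> RtoC 0).
  { intro H0; rewrite H0, Cmult_0_r in HN; apply N; now apply RtoC_inj. }
  simpl; field; auto.
Qed.

(** * Symmetry of second partial derivatives *)

Lemma Ck_is_partial (k : nat) (G : point -> Prop) (F : point -> C) (a : axis)
    (P : point) :
  Ck (S k) G F -> G P -> is_partial a F P (partial a F P).
Proof. intros [_ H] HP; apply ex_partial_correct; now apply (H a). Qed.

Lemma Ck_is_partial2 (k : nat) (G : point -> Prop) (F : point -> C)
    (a b : axis) (P : point) :
  Ck (S (S k)) G F -> G P ->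
  is_partial b (partial a F) P (partial b (partial a F) P).
Proof. intros [_ H] HP; apply (Ck_is_partial k G); [apply (H a) | exact HP]. Qed.

Lemma Ck_continuous (k : nat) (G : point -> Prop) (F : point -> C) (P : point) :
  Ck k G F -> G P -> continuous F P.
Proof. destruct k; intros [H _]; apply H. Qed.

Lemma Ck_partial (k : nat) (G : point -> Prop) (F : point -> C) (a : axis) :
  Ck (S k) G F -> Ck k G (partial a F).
Proof. intros [_ H]; apply H. Qed.

(** Schwarz's theorem for one real component of [F]: [pr] stands for [Re] or
    [Im], and its last two hypotheses say that [pr] commutes with partial
    derivatives.  The theorem for functions of two real variables is applied on
    the coordinate plane through [P] spanned by [a] and [b]. *)
Lemma Schwarz_component (pr : C -> R) (G : point -> Prop) (F : point -> C)
    (a b : axis) (P : point) :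
  a <> b -> open G -> G P -> Ck 2 G F ->
  (forall z, continuous pr z) ->
  (forall (H : point -> C) (c : axis) (S : point),
     pr (partial c H S) = Derive (fun t => pr (along H c S t)) (coord c S)) ->
  (forall (H : point -> C) (c : axis) (S : point) l, is_partial c H S l ->
     ex_derive (fun t => pr (along H c S t)) (coord c S)) ->
  pr (partial a (partial b F) P) = pr (partial b (partial a F) P).
Proof.
intros Hab HG HP HF Hcont Hpr Hex.
assert (Hba : b <> a) by congruence.
set (f := fun u v => pr (F (plane a b P (u, v)))).
(* Partial derivatives in space are derivatives of the restriction to the
   plane, at every point of the plane. *)
assert (Ea : forall H u v,
  pr (partial a H (plane a b P (u, v))) =
  Derive (fun s => pr (H (plane a b P (s, v)))) u).
{ intros H u v; rewrite Hpr; unfold plane, along; simpl.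
  rewrite coord_set_coord; apply Derive_ext; intro s.
  now rewrite set_coord_twice. }
assert (Eb : forall H u v,
  pr (partial b H (plane a b P (u, v))) =
  Derive (fun s => pr (H (plane a b P (u, s)))) v).
{ intros H u v; rewrite Hpr; unfold plane, along; simpl.
  rewrite set_coord_comm, coord_set_coord by assumption.
  apply Derive_ext; intro s.
  now rewrite set_coord_twice, set_coord_comm by assumption. }
assert (Xa : forall H u v l, is_partial a H (plane a b P (u, v)) l ->
  ex_derive (fun s => pr (H (plane a b P (s, v)))) u).
{ intros H u v l Hl; apply Hex in Hl; unfold plane, along in *; simpl in *.
  rewrite coord_set_coord in Hl; revert Hl; apply ex_derive_ext; intro s.
  now rewrite set_coord_twice. }
assert (Xb : forall H u v l, is_partial b H (plane a b P (u, v)) l ->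
  ex_derive (fun s => pr (H (plane a b P (u, s)))) v).
{ intros H u v l Hl; apply Hex in Hl; unfold plane, along in *; simpl in *.
  rewrite set_coord_comm, coord_set_coord in Hl by assumption.
  revert Hl; apply ex_derive_ext; intro s.
  now rewrite set_coord_twice, set_coord_comm by assumption. }
assert (Eab : forall u v,
  Derive (fun z => Derive (fun t => f z t) v) u =
  pr (partial a (partial b F) (plane a b P (u, v)))).
{ intros u v; rewrite Ea; apply Derive_ext; intro s; now rewrite Eb. }
assert (Eba : forall u v,
  Derive (fun z => Derive (fun t => f t z) u) v =
  pr (partial b (partial a F) (plane a b P (u, v)))).
{ intros u v; rewrite Eb; apply Derive_ext; intro s; now rewrite Ea. }
assert (Hc2 : forall c d, continuity_2d_pt
  (fun u v => pr (partial c (partial d F) (plane a b P (u, v))))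
  (coord a P) (coord b P)).
{ intros c d; apply continuity_2d_pt_filterlim.
  change (continuous
    (fun z : R * R => pr (partial c (partial d F) (plane a b P z)))
    (coord a P, coord b P)).
  apply (continuous_comp
    (fun z : R * R => partial c (partial d F) (plane a b P z)) pr);
    [|apply Hcont].
  apply (continuous_comp (plane a b P) (partial c (partial d F)));
    [apply continuous_plane|].
  rewrite plane_id; apply (Ck_continuous 0 G); [|exact HP].
  now apply Ck_partial, Ck_partial. }
(* Both mixed derivatives exist near [P] because [G] is open. *)
generalize (Schwarz f (coord a P) (coord b P)).
rewrite Eab, Eba, plane_id; intro HS; apply HS; clear HS.
- generalize (open_locally_plane G a b P HG HP).
  apply locally_2d_impl, locally_2d_forall; intros u v Huv.
  repeat split.
  + apply (Xa F _ _ _ (Ck_is_partial 1 G F a _ HF Huv)).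
  + apply (Xb F _ _ _ (Ck_is_partial 1 G F b _ HF Huv)).
  + apply (ex_derive_ext (fun s => pr (partial b F (plane a b P (s, v))))).
    { intro s; apply Eb. }
    apply (Xa _ _ _ _ (Ck_is_partial2 0 G F b a _ HF Huv)).
  + apply (ex_derive_ext (fun s => pr (partial a F (plane a b P (u, s))))).
    { intro s; apply Ea. }
    apply (Xb _ _ _ _ (Ck_is_partial2 0 G F a b _ HF Huv)).
- apply (continuity_2d_pt_ext (fun u v =>
    pr (partial a (partial b F) (plane a b P (u, v))))); [now intros; rewrite Eab|].
  apply Hc2.
- apply (continuity_2d_pt_ext (fun u v =>
    pr (partial b (partial a F) (plane a b P (u, v))))); [now intros; rewrite Eba|].
  apply Hc2.
Qed.

Lemma partial_comm (G : point -> Prop) (F : point -> C) (a b : axis) (P : point) :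
  open G -> G P -> Ck 2 G F ->
  partial a (partial b F) P = partial b (partial a F) P.
Proof.
intros HG HP HF.
assert (Hab : a = b \/ a <> b) by (destruct a, b; (now left) || now right).
destruct Hab as [->|Hab]; [reflexivity|].
apply injective_projections.
- apply (Schwarz_component Re G); try assumption.
  + intros [x y]; apply continuous_fst.
  + reflexivity.
  + intros H c S l [H1 _]; eexists; exact H1.
- apply (Schwarz_component Im G); try assumption.
  + intros [x y]; apply continuous_snd.
  + reflexivity.
  + intros H c S l [_ H2]; eexists; exact H2.
Qed.

(** * Components of quaternionic operators *)

Lemma partial_const (a : axis) (c : C) (P : point) : partial a (fun _ => c) P = 0%C.
Proof. unfold partial, CDerive, along; now rewrite !Derive_const. Qed.

(** On a purely vectorial field, [D] is minus the divergence plus the curl. *)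
Lemma D_vector_field (Q : point -> HC) (W : point -> axis -> C) (P : point) :
  (forall S, Q S = mkHC 0 (W S ax_x) (W S ax_y) (W S ax_z)) ->
  let d a b := partial a (fun S => W S b) P in
  D_op Q P =
  mkHC (- div W P)
    (d ax_y ax_z - d ax_z ax_y) (d ax_z ax_x - d ax_x ax_z)
    (d ax_x ax_y - d ax_y ax_x).
Proof.
intros HQ d.
assert (E0 : forall a, partial a (fun S => Q0 (Q S)) P = 0%C).
{ intro a; rewrite <- (partial_const a 0%C P).
  unfold partial, CDerive, along; f_equal; apply Derive_ext; intro t;
    now rewrite HQ. }
assert (Ex : forall a, partial a (fun S => Q1 (Q S)) P = d a ax_x).
{ intro a; unfold d, partial, CDerive, along; f_equal; apply Derive_ext; intro t;
    now rewrite HQ. }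
assert (Ey : forall a, partial a (fun S => Q2 (Q S)) P = d a ax_y).
{ intro a; unfold d, partial, CDerive, along; f_equal; apply Derive_ext; intro t;
    now rewrite HQ. }
assert (Ez : forall a, partial a (fun S => Q3 (Q S)) P = d a ax_z).
{ intro a; unfold d, partial, CDerive, along; f_equal; apply Derive_ext; intro t;
    now rewrite HQ. }
unfold D_op, Hpartial; rewrite !E0, !Ex, !Ey, !Ez.
unfold div, Hplus, Hmult, Hi, Hj, Hk; simpl.
fold (d ax_x ax_x) (d ax_y ax_y) (d ax_z ax_z).
f_equal; ring.
Qed.

(** For scalar [g], the field [(D - M^(Df/f)) g] is [grad g - g grad f / f]; its
    scalar component is zero at every point of space, even where [f] vanishes. *)
Lemma D_minus_M_scalar (f g : point -> C) (P : point) :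
  let W a := (partial a g P - g P * (/ f P * partial a f P))%C in
  op_minus D_op (M_op (D_log f)) (scalar_field g) P =
  mkHC 0 (W ax_x) (W ax_y) (W ax_z).
Proof.
unfold op_minus, M_op, D_log; rewrite !D_scalar_field.
unfold Hminus, Hmult, Hscale, scalar_field, Hscalar, grad; simpl.
f_equal; ring.
Qed.

(** * The factorization *)

Theorem theorem45 :
  forall (G : point -> Prop) (p q sqrt_p u0 phi : point -> C),
    is_domain G ->
    Ck 2 G p ->
    (forall P, G P -> p P <> 0%C) ->
    Ck 2 G sqrt_p ->
    (forall P, G P -> (sqrt_p P * sqrt_p P)%C = p P) ->
    Ck 2 G u0 ->
    (forall P, G P -> u0 P <> 0%C) ->
    (forall P, G P -> div_p_grad_plus_q p q u0 P = 0%C) ->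
    Ck 2 G phi ->
    let f := fun P : point => (sqrt_p P * u0 P)%C in
    forall P, G P ->
      Hscalar (div_p_grad_plus_q p q phi P) =
      Hscale (- sqrt_p P)%C
        (op_plus D_op (M_op (D_log f))
           (op_minus D_op (M_op (D_log f))
              (scalar_field (fun S => (sqrt_p S * phi S)%C))) P).
Proof.
intros G p q s u phi [HG _] Hp Hp0 Hs Hsp Hu Hu0 Heq Hphi f P HP.
assert (Hs0 : forall S, G S -> s S <> 0%C).
{ intros S HS H0; apply (Hp0 S HS); rewrite <- (Hsp S HS), H0; ring. }
assert (Ds : forall S, G S -> forall a, is_partial a s S (partial a s S))
  by (intros S HS a; now apply (Ck_is_partial 1 G)).
assert (Du : forall S, G S -> forall a, is_partial a u S (partial a u S))
  by (intros S HS a; now apply (Ck_is_partial 1 G)).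
assert (Dphi : forall S, G S -> forall a, is_partial a phi S (partial a phi S))
  by (intros S HS a; now apply (Ck_is_partial 1 G)).
set (W := fun S a => (partial a (fun T => s T * phi T) S -
  s S * phi S * (/ f S * partial a f S))%C).
assert (Ef : forall S, G S -> forall a,
  partial a f S = (partial a s S * u S + s S * partial a u S)%C).
{ intros S HS a; apply is_partial_unique, is_partial_mult; auto. }
(* The derivatives of [s] cancel in [W], so first derivatives of [s] are enough
   to differentiate it. *)
assert (EW : forall S, G S -> forall a,
  W S a = (s S * (partial a phi S - phi S * (partial a u S * / u S)))%C).
{ intros S HS a; unfold W; rewrite Ef by exact HS.
  rewrite (is_partial_unique _ _ _ _
    (is_partial_mult _ _ _ _ _ _ (Ds S HS a) (Dphi S HS a))).
  unfold f; field; auto. }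
assert (DW : forall a b, partial b (fun S => W S a) P =
  (partial b s P * (partial a phi P - phi P * (partial a u P * / u P)) +
   s P * (partial b (partial a phi) P -
     (partial b phi P * (partial a u P * / u P) +
      phi P * (partial b (partial a u) P * / u P +
               partial a u P * (- partial b u P / (u P * u P))))))%C).
{ intros a b; apply is_partial_unique.
  refine (is_partial_ext_open G b _ _ P _ HG HP
    (fun S HS => eq_sym (EW S HS a)) _).
  apply (is_partial_mult b s); [auto|].
  apply is_partial_minus; [now apply (Ck_is_partial2 0 G)|].
  apply (is_partial_mult b phi); [auto|].
  apply (is_partial_mult b (partial a u)); [now apply (Ck_is_partial2 0 G)|].
  apply is_partial_inv; auto. }
(* On [G], [p] is the square of [s]; both sides of the identity are thereby
   expressed through derivatives of [s]. *)
assert (Ediv : forall g, Ck 2 G g -> forall a,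
  partial a (fun S => p S * grad g S a)%C P =
  ((partial a s P * s P + s P * partial a s P) * partial a g P +
   s P * s P * partial a (partial a g) P)%C).
{ intros g Hg a; apply is_partial_unique.
  apply (is_partial_ext_open G a (fun S => s S * s S * partial a g S)%C); auto.
  { intros S HS; unfold grad; now rewrite Hsp. }
  apply (is_partial_mult a (fun S => s S * s S)%C);
    [apply is_partial_mult; auto | now apply (Ck_is_partial2 0 G)]. }
assert (Heq' := Heq P HP).
unfold div_p_grad_plus_q, div in Heq' |- *.
rewrite !Ediv in Heq' |- * by assumption.
unfold op_plus.
rewrite (D_vector_field _ W P) by (intro S; apply D_minus_M_scalar).
(* Only the outer multiplication is evaluated; the inner one is covered by
   [D_minus_M_scalar]. *)
match goal with |- context [M_op ?A ?Q P] =>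
  change (M_op A Q P) with (Hmult (Q P) (A P)) end.
rewrite D_minus_M_scalar; cbv beta zeta.
fold (W P ax_x) (W P ax_y) (W P ax_z).
unfold D_log; rewrite D_scalar_field.
unfold div; rewrite !DW, !EW by exact HP.
unfold grad; rewrite !Ef by exact HP.
rewrite (partial_comm G phi ax_y ax_x), (partial_comm G phi ax_z ax_x),
  (partial_comm G phi ax_z ax_y), (partial_comm G u ax_y ax_x),
  (partial_comm G u ax_z ax_x), (partial_comm G u ax_z ax_y) by assumption.
unfold f, Hscalar, Hscale, Hplus, Hmult; simpl.
assert (Us := Hs0 P HP); assert (Uu := Hu0 P HP).
(* The equation for [u] gives [q = - div (p grad u) / u] at [P]. *)
match type of Heq' with (?A + _)%C = _ =>
  assert (Eq : q P = (- A / u P)%C) by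
    (rewrite <- (Cplus_0_r (- A)), <- Heq'; field; assumption) end.
rewrite Eq.
f_equal; field; auto.
Qed.
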